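(* Let $\lambda_i>0$, $i=1,\dots,k$, and put $\lambda_{ij}=\lambda_i$ for all $i,j=1,\dots,k$, $j\ne i$. Let $(\chi,\psi)\in\mathscr F$ satisfy the following conditions, with $l_n,V_n,R_n$ corresponding to these $\lambda_{ij}$: (a) for any $r=1,2,\dots$, $I_{\{l_r^\chi<f_{\theta_1}^{r,\chi}+R_r^\chi\}}\le\psi_r^\chi\le I_{\{l_r^\chi\le f_{\theta_1}^{r,\chi}+R_r^\chi\}}$ $\mu^r$-almost everywhere on $C_r^{\psi,\chi}$; (b) for any $r=1,2,\dots$, $\int V_{r+1}^\chi(y^{(r+1)})\,d\mu(y_{r+1})=R_r^\chi(y^{(r)})$ $\mu^r$-almost everywhere on $\bar C_r^{\psi,\chi}$; (c) $\int V_1^\chi\,d\mu(y_1)=R_0$. Let $\phi$ be any decision rule such that $$\phi_{nj}\le I_{\left\{\sum_{i\ne j}\lambda_if_{\theta_i}^n=\min_{j'}\sum_{i\ne j'}\lambda_if_{\theta_i}^n\right\}}\quad\text{for any } j=1,\dots,k\text{ and any } n=1,2,\dots$$ Then for any sequential testing procedure $(\chi',\psi',\phi')$ with $(\chi',\psi')\in\mathscr F$ such that $$\beta_i(\chi',\psi',\phi')\le\beta_i(\chi,\psi,\phi)\quad\text{for any } i=1,\dots,k,\qquad(1)$$ it holds $$N(\chi',\psi')\ge N(\chi,\psi).\qquad(2)$$ The inequality in (2) is strict if at least one of the inequalities in (1) is strict. If there are equalities in all of the inequalities in (1) and (2), then $(\chi',\psi')$ satisfies conditions (a), (b), (c) with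 $\lambda_{ij}=\lambda_i$ as well (with $\chi'$ instead of $\chi$ and $\psi'$ instead of $\psi$).
   Context: Model. There are $k\ge 2$ simple hypotheses $H_i:\theta=\theta_i$, $i=1,\dots,k$. A control variable takes values in a measurable space $\mathcal X$; observations take values in a measurable space $\mathcal Y$ with a $\sigma$-finite measure $\mu$. Under parameter $\theta$ and control $x$, an observation has density $f_\theta(y|x)$ with respect to $\mu$. Given controls $x_1,\dots,x_n$, the observations are independent, with joint density $f_\theta^n=f_\theta^n(x^{(n)},y^{(n)})=\prod_{i=1}^n f_\theta(y_i|x_i)$ with respect to $\mu^n=\mu\otimes\cdots\otimes\mu$. Here $x^{(n)}=(x_1,\dots,x_n)$, $y^{(n)}=(y_1,\dots,y_n)$. Procedures. A sequential testing procedure is a triplet $(\chi,\psi,\phi)$: a control policy $\chi=(\chi_1,\chi_2,\dots)$ of measurable functions $\chi_n=\chi_n(x^{(n-1)},y^{(n-1)})$ with values in $\mathcal X$ ($\chi_1$ is a fixed element of $\mathcal X$); a stopping rule $\psi=(\psi_1,\psi_2,\dots)$ of measurable functions $\psi_n=\psi_n(x^{(n)},y^{(n)})\in[0,1]$ (conditional probability of stopping at stage $n$ given that stage $n$ is reached); and a decision rule $\phi=(\phi_1,\phi_2,\dots)$, $\phi_n=(\phi_{n1},\dots,\phi_{nk})$, of measurable functions $\phi_{nj}=\phi_{nj}(x^{(n)},y^{(n)})\ge0$ with $\sum_{j=1}^k\phi_{nj}\equiv1$ (conditional probability of accepting $H_j$ when stopping at stage $n$). At each stage the control $x_n=\chi_n(x^{(n-1)},y^{(n-1)})$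 is applied and then $y_n$ is observed. A pair $(\chi,\psi)$ is called a strategy. Notation. For $F_n=F_n(x^{(n)},y^{(n)})$, $F_n^\chi(y^{(n)})$ denotes $F_n(x^{(n)},y^{(n)})$ with $x_i=\chi_i(x^{(i-1)},y^{(i-1)})$, $i=1,\dots,n$; $f_\theta^{n,\chi}$ is the density of $Y^{(n)}$ under $\theta$ and $\chi$, and $E_\theta^\chi F_n=\int F_n^\chi f_\theta^{n,\chi}d\mu^n$. $I_A$ is the indicator of $A$. The stopping time $\tau_\psi$ satisfies $P_\theta^\chi(\tau_\psi=n)=E_\theta^\chi(1-\psi_1)\cdots(1-\psi_{n-1})\psi_n$. $C_n^{\psi,\chi}=\{y^{(n)}:(1-\psi_1^\chi(y^{(1)}))\cdots(1-\psi_{n-1}^\chi(y^{(n-1)}))>0\}$ for $n\ge2$, $C_1^{\psi,\chi}$ is the whole space of $y^{(1)}$, and $\bar C_n^{\psi,\chi}=\{y^{(n)}:(1-\psi_1^\chi(y^{(1)}))\cdots(1-\psi_n^\chi(y^{(n)}))>0\}$ for $n\ge1$. Characteristics. $\alpha_{ij}(\chi,\psi,\phi)=\sum_{n=1}^\infty E_{\theta_i}^\chi(1-\psi_1)\cdots(1-\psi_{n-1})\psi_n\phi_{nj}$ (probability of accepting $H_j$ under $\theta_i$), and $\beta_i(\chi,\psi,\phi)=\sum_{j\ne i}\alpha_{ij}(\chi,\psi,\phi)$. $N(\chi,\psi)=E_{\theta_1}^\chi\tau_\psi=\sum_{n\ge1}nP_{\theta_1}^\chi(\tau_\psi=n)$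 if $P_{\theta_1}^\chi(\tau_\psi<\infty)=1$, and $\infty$ otherwise. Class. $\mathscr F$ is the set of all strategies $(\chi,\psi)$ with $\lim_{n\to\infty}E_{\theta_i}^\chi(1-\psi_1)\cdots(1-\psi_n)=0$ for every $i=1,\dots,k$ (equivalently, $P_{\theta_i}^\chi(\tau_\psi<\infty)=1$ for all $i$). Functions $l_n,V_n,R_n$. $l_n=\min_{1\le j\le k}\sum_{i\ne j}\lambda_{ij}f_{\theta_i}^n$. For $N\ge1$ let $V_N^N=l_N$ and, recursively for $n=N,N-1,\dots,2$, $V_{n-1}^N=\min\{l_{n-1},f_{\theta_1}^{n-1}+R_{n-1}^N\}$ with $R_{n-1}^N(x^{(n-1)},y^{(n-1)})=\min_{x_n}\int V_n^N(x^{(n)},y^{(n)})d\mu(y_n)$. The sequence $V_n^N$ is non-increasing in $N$; $V_n=\lim_{N\to\infty}V_n^N$, $R_n(x^{(n)},y^{(n)})=\min_{x_{n+1}}\int V_{n+1}(x^{(n+1)},y^{(n+1)})d\mu(y_{n+1})$ for $n\ge1$, and $R_0=\min_{x_1}\int V_1(x_1,y_1)d\mu(y_1)$. Standing assumption: all these functions defined by minima over the control are well-defined (minima attained) and measurable. *)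

(* Defs.v *)
From HB Require Import structures.
From mathcomp Require Import all_boot all_order all_algebra.
From mathcomp Require Import all_classical all_reals all_analysis.
From mathcomp Require Import measurable_realfun.

Set Implicit Arguments.
Unset Strict Implicit.
Unset Printing Implicit Defensive.

Import Order.TTheory GRing.Theory Num.Theory.
Import numFieldNormedType.Exports.

Local Open Scope classical_set_scope.
Local Open Scope ring_scope.

Definition tinit (T : Type) n (t : n.+1.-tuple T) : n.-tuple T :=
  [tuple tnth t (widen_ord (leqnSn n) i) | i < n].

Definition trcons (T : Type) n (t : n.-tuple T) (a : T) : n.+1.-tuple T :=
  [tuple of rcons t a].

Lemma tinitK (T : Type) n (t : n.+1.-tuple T) :
  trcons (tinit t) (tnth t ord_max) = t.
Proof.
set a := tnth t ord_max; apply: eq_from_tnth => i.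
rewrite (tnth_nth a) /= nth_rcons (size_tuple (tinit t)).
case: ltnP => [lt_in|].
  have := tnth_nth a (tinit t) (Ordinal lt_in); rewrite tnth_mktuple /= => <-.
  by congr tnth; exact: val_inj.
rewrite leq_eqVlt ltnNge -ltnS ltn_ord orbF => /eqP n_i; rewrite -n_i eqxx.
by rewrite /a; congr tnth; exact: val_inj.
Qed.

Lemma tinit_trcons (T : Type) n (t : n.-tuple T) (a : T) :
  tinit (trcons t a) = t.
Proof.
apply: eq_from_tnth => i; rewrite tnth_mktuple !(tnth_nth a) /= nth_rcons.
by rewrite size_tuple ltn_ord.
Qed.

Section power_measure.
Local Open Scope ereal_scope.
Context dY (Y : measurableType dY) (R : realType).
Variable mu : {sigma_finite_measure set Y -> \bar R}.

Lemma measurable_trcons n :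
  measurable_fun setT (fun p : n.-tuple Y * Y => trcons p.1 p.2).
Proof.
apply/measurable_fun_tnthP => i /=.
have [lt_in|le_ni] := ltnP i n.
  rewrite (_ : _ \o _ = (fun t : n.-tuple Y => tnth t (Ordinal lt_in)) \o fst).
    by apply: measurableT_comp => //; exact: measurable_tnth.
  apply/funext => p /=; rewrite !(tnth_nth p.2) /= nth_rcons size_tuple.
  by rewrite lt_in.
rewrite (_ : _ \o _ = snd)//.
apply/funext => p /=; rewrite (tnth_nth p.2) /= nth_rcons size_tuple.
by rewrite ltnNge le_ni /=; case: ifP.
Qed.

(* The product measure mu^n on Y^n, with mu^0 the unit mass at the empty
   tuple and mu^(n+1) = mu^n (x) mu through Y^n * Y ~ Y^(n+1). *)
Fixpoint mupow n : set (n.-tuple Y) -> \bar R :=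
  match n with
  | 0 => dirac ([tuple] : 0.-tuple Y)
  | m.+1 => pushforward (@mupow m \x mu) (fun p => trcons p.1 p.2)
  end.

Lemma mupow_measure n :
  exists m : {measure set (n.-tuple Y) -> \bar R}, @mupow n = m.
Proof.
elim: n => [|n [m IH]]; first by eexists.
exists (measure_function_pushforward__canonical__measure_function_Measure
  (m \x mu)%E (@measurable_trcons n)).
by rewrite /= IH.
Qed.

Let mupow0 n : @mupow n set0 = 0.
Proof. by have [m ->] := mupow_measure n; exact: measure0. Qed.

Let mupow_ge0 n A : 0 <= @mupow n A.
Proof. by have [m ->] := mupow_measure n; exact: measure_ge0. Qed.

Let mupow_sigma_additive n : semi_sigma_additive (@mupow n).
Proof.
by have [m ->] := mupow_measure n; exact: measure_semi_sigma_additive.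
Qed.

HB.instance Definition _ n := isMeasure.Build _ _ _ (@mupow n)
  (@mupow0 n) (@mupow_ge0 n) (@mupow_sigma_additive n).

End power_measure.
Arguments mupow {dY Y R} mu n.

Section model.
Context dX dY (X : measurableType dX) (Y : measurableType dY) (R : realType).
Variable mu : {sigma_finite_measure set Y -> \bar R}.
Context (k : nat).

(* Histories (x^(n), y^(n)). *)
Definition hist n : Type := (n.-tuple X * n.-tuple Y)%type.

Definition hist_init n (h : hist n.+1) : hist n := (tinit h.1, tinit h.2).

Definition hist_rcons n (h : hist n) (x : X) (y : Y) : hist n.+1 :=
  (trcons h.1 x, trcons h.2 y).

(* f i (x, y) is the density f_{theta_i}(y | x) with respect to mu. *)
Definition density_family (f : 'I_k -> X * Y -> R) : Prop :=
  forall i, [/\ measurable_fun setT (f i), (forall xy, 0 <= f i xy) &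
    forall x, (\int[mu]_y (f i (x, y))%:E = 1)%E].

(* chi n is the control chi_{n+1}, a function of the n first controls and
   observations.  psi n and phi n are psi_{n+1} and phi_{n+1}: stages are
   numbered from 0 here, and stage n bears on histories of length n.+1. *)
Definition control := forall n, hist n -> X.
Definition stopping := forall n, hist n.+1 -> R.
Definition decision := forall n, 'I_k -> hist n.+1 -> R.

Definition control_policy (chi : control) : Prop :=
  forall n, measurable_fun setT (chi n).

Definition stopping_rule (psi : stopping) : Prop :=
  forall n, measurable_fun setT (psi n) /\ (forall h, 0 <= psi n h <= 1).

Definition decision_rule (phi : decision) : Prop :=
  forall n, [/\ (forall j, measurable_fun setT (phi n j)),
    (forall j h, 0 <= phi n j h) & forall h, \sum_(j < k) phi n j h = 1].

Fixpoint controls (chi : control) n : n.-tuple Y -> n.-tuple X :=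
  match n with
  | 0 => fun _ => [tuple]
  | m.+1 => fun y =>
      let xs := controls chi (tinit y) in trcons xs (chi m (xs, tinit y))
  end.

(* The history generated by chi and the observations y; the function F^chi
   is F composed with (run chi). *)
Definition run (chi : control) n (y : n.-tuple Y) : hist n :=
  (controls chi y, y).

Section density.
Variable f : 'I_k -> X * Y -> R.

Definition joint_density (i : 'I_k) n (h : hist n) : R :=
  \prod_(m < n) f i (tnth h.1 m, tnth h.2 m).

Definition expectation_under (chi : control) (i : 'I_k) n (F : hist n -> R)
    : \bar R :=
  (\int[mupow mu n]_y (F (run chi y) * joint_density i (run chi y))%:E)%E.

(* (1 - psi_1) ... (1 - psi_n) as a function of (x^(n), y^(n)). *)
Fixpoint continue (psi : stopping) n : hist n -> R :=
  match n with
  | 0 => fun _ => 1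
  | m.+1 => fun h => continue psi (hist_init h) * (1 - psi m h)
  end.

(* (1 - psi_1) ... (1 - psi_n) psi_{n+1} *)
Definition stop_at (psi : stopping) n (h : hist n.+1) : R :=
  continue psi (hist_init h) * psi n h.

(* P_{theta_i}^chi (tau_psi = n + 1) *)
Definition prob_tau chi psi (i : 'I_k) n : \bar R :=
  expectation_under chi i (@stop_at psi n).

Definition alpha chi psi (phi : decision) (i j : 'I_k) : \bar R :=
  (\sum_(n <oo)
     expectation_under chi i (fun h => stop_at psi h * phi n j h)%R)%E.

Definition beta chi psi phi (i : 'I_k) : \bar R :=
  (\sum_(j < k | j != i) alpha chi psi phi i j)%E.

(* i1 is the index of the first hypothesis. *)
Definition sample_number (i1 : 'I_k) chi psi : \bar R :=
  (if \sum_(n <oo) prob_tau chi psi i1 n == 1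
   then \sum_(n <oo) n.+1%:R%:E * prob_tau chi psi i1 n else +oo)%E.

Definition classF chi psi : Prop :=
  [/\ control_policy chi, stopping_rule psi &
    forall i, (fun n => expectation_under chi i (@continue psi n)) @ \oo
                --> (0%E : \bar R)].

(* C_{n+1}^{psi,chi}; it constrains only the n first observations. *)
Definition Cset chi psi n : set (n.+1.-tuple Y) :=
  [set y | 0 < continue psi (hist_init (run chi y))].

(* \bar C_n^{psi,chi} *)
Definition Cbar chi psi n : set (n.-tuple Y) :=
  [set y | 0 < continue psi (run chi y)].

Section bellman.
Variables (i1 : 'I_k) (lambda : 'I_k -> 'I_k -> R).
Local Open Scope ereal_scope.

Definition decision_loss n (j : 'I_k) (h : hist n) : R :=
  (\sum_(i < k | i != j) lambda i j * joint_density i h)%R.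

Definition lfun n (h : hist n) : \bar R :=
  \big[mine/+oo]_(j < k) (decision_loss j h)%:E.

Definition integral_next n (F : hist n.+1 -> \bar R) (h : hist n) (x : X)
    : \bar R :=
  \int[mu]_y F (hist_rcons h x y).

(* The minimum over the control of the integral; it is written as an infimum,
   whose attainment is the first clause of min_control_defined. *)
Definition min_control n (F : hist n.+1 -> \bar R) (h : hist n) : \bar R :=
  ereal_inf (range (integral_next F h)).

Definition min_control_defined n (F : hist n.+1 -> \bar R) : Prop :=
  (forall h, exists x, integral_next F h x = min_control F h) /\
  measurable_fun setT (min_control F).

(* V_n^{n+s}, by recursion on the number s of remaining steps. *)
Fixpoint Vsteps (s : nat) n : hist n -> \bar R :=
  match s with
  | 0 => @lfun n
  | s'.+1 => fun h =>
      mine (lfun h) ((joint_density i1 h)%:E + min_control (@Vsteps s' n.+1) h)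
  end.

(* V_n^N, meaningful for n <= N. *)
Definition VN (N n : nat) : hist n -> \bar R := @Vsteps (N - n) n.

(* R_n^N, meaningful for n < N. *)
Definition RN (N n : nat) : hist n -> \bar R := min_control (@VN N n.+1).

Lemma VNN N : @VN N N = @lfun N.
Proof. by rewrite /VN subnn. Qed.

Lemma VN_rec N n (h : hist n) : (n < N)%N ->
  VN N h = mine (lfun h) ((joint_density i1 h)%:E + RN N h).
Proof. by move=> nN; rewrite /RN /VN -(subnSK nN). Qed.

Definition Vlim n (h : hist n) : \bar R := limn (fun N => VN N h).

Definition Rlim n : hist n -> \bar R := min_control (@Vlim n.+1).

Definition minima_defined : Prop :=
  (forall N n, (1 <= n < N)%N -> min_control_defined (@VN N n.+1)) /\
  (forall n, min_control_defined (@Vlim n.+1)).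

(* r.+1 below is the stage r = 1, 2, ... of conditions (a) and (b). *)
Definition condition_a chi psi : Prop :=
  forall r, {ae mupow mu r.+1, forall y, Cset chi psi y ->
    (\1_[set h : hist r.+1 | (lfun h < (joint_density i1 h)%:E + Rlim h)%E]
       (run chi y) <= psi r (run chi y)
     <= \1_[set h : hist r.+1 | (lfun h <= (joint_density i1 h)%:E + Rlim h)%E]
       (run chi y))%R}.

Definition condition_b chi psi : Prop :=
  forall r, {ae mupow mu r.+1, forall y, Cbar chi psi y ->
    \int[mu]_z Vlim (run chi (trcons y z)) = Rlim (run chi y)}.

Definition condition_c (chi : control) : Prop :=
  \int[mu]_y Vlim (run chi [tuple y]) = Rlim (([tuple], [tuple]) : hist 0).

Definition conditions_abc chi psi : Prop :=
  [/\ condition_a chi psi, condition_b chi psi & condition_c chi].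

Definition optimal_decision (phi : decision) : Prop :=
  forall n j h, (phi n j h <=
    \1_[set g : hist n.+1 | (decision_loss j g)%:E = lfun g] h)%R.

End bellman.
End density.
End model.

Definition first_hyp k (hk : (2 <= k)%N) : 'I_k := Ordinal (ltnW hk).

(* Main.v *)
From HB Require Import structures.
Require Import Defs.
From mathcomp Require Import all_boot all_order all_algebra.
From mathcomp Require Import all_classical all_reals all_analysis.
From mathcomp Require Import measurable_realfun ring zify.
Import Order.TTheory GRing.Theory Num.Theory.
Import numFieldNormedType.Exports.
Local Open Scope ring_scope.

(* Let c_n = (1 - psi_1) ... (1 - psi_n) and s_n = c_(n-1) psi_n.  Since R_n is
   at most the integral of V_(n+1), and V_(n+1) = min(l, f_1 + R) is at most any
   mixture of its two arguments,
     int c_n R_n <= int c_n V_(n+1)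
                 <= int s_(n+1) l_(n+1) + int c_(n+1) (f_1 + R_(n+1)),
   with equalities exactly under (b), (c) and under (a).  Membership in F makes
   int c_n R_n tend to 0, so telescoping gives R_0 + 1 <= sum_n int s_n l_n + N,
   with equality iff (a), (b), (c) hold.  The sum is at most
   sum_i lambda_i beta_i, with equality when phi is the optimal decision rule.
   Hence (chi, psi, phi) minimises N + sum_i lambda_i beta_i with minimum
   R_0 + 1, and the three claims follow by comparing this value with that of
   (chi', psi', phi'). *)

Set Implicit Arguments.
Unset Strict Implicit.
Unset Printing Implicit Defensive.

Local Open Scope classical_set_scope.

(** * Products of the dominating measure *)

Section tuple.

Lemma measurable_tinit d (T : measurableType d) n :
  measurable_fun setT (@tinit T n).
Proof.
apply/measurable_fun_tnthP => i.
rewrite (_ : _ \o _ = (@tnth _ T)^~ (widen_ord (leqnSn n) i)).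
  exact: measurable_tnth.
by apply/funext => t; rewrite /= tnth_mktuple.
Qed.

Lemma tnth_trcons_last (T : Type) n (t : n.-tuple T) a :
  tnth (trcons t a) ord_max = a.
Proof. by rewrite (tnth_nth a) /= nth_rcons size_tuple ltnn eqxx. Qed.

Lemma tnth_trcons_widen (T : Type) n (t : n.-tuple T) a (i : 'I_n) :
  tnth (trcons t a) (widen_ord (leqnSn n) i) = tnth t i.
Proof. by rewrite -{2}(tinit_trcons t a) tnth_mktuple. Qed.

Lemma measurable_fun_trcons d d' (S : measurableType d) (T : measurableType d')
    n (g : S -> n.-tuple T) (a : S -> T) :
  measurable_fun setT g -> measurable_fun setT a ->
  measurable_fun setT (fun s => trcons (g s) (a s)).
Proof.
move=> mg ma.
apply: (measurableT_comp (f := fun p : n.-tuple T * T => trcons p.1 p.2)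
  (g := fun s => (g s, a s))); first exact: measurable_trcons.
exact: measurable_fun_pair.
Qed.

End tuple.

Section mupow.
Context d (Y : measurableType d) (R : realType).
Variable mu : {sigma_finite_measure set Y -> \bar R}.
Local Open Scope ereal_scope.

(** Rectangles built from increasing exhaustions of [Y^n] and [Y] have finite measure; monotonicity
    lets the larger of two indices serve both factors. *)
Lemma sigma_finite_mupow n : sigma_finite setT (mupow mu n).
Proof.
elim: n => [|n IH].
  exists (fun=> setT); first by rewrite bigcup_const.
  move=> i; split; first exact: measurableT.
  by rewrite /= diracT ltry.
have /sigma_finiteP[F [TF ndF Foo]] := IH.
have /sigma_finiteP[G [TG ndG Goo]] := sigma_finiteT mu.
exists (fun i =>
  [set t : n.+1.-tuple Y | F i (tinit t) /\ G i (tnth t ord_max)]).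
  apply/seteqP; split => t // _.
  have : [set: n.-tuple Y] (tinit t) by [].
  have : [set: Y] (tnth t ord_max) by [].
  rewrite TG TF => -[i _ Gi] [j _ Fj]; exists (maxn i j) => //; split.
    by move: Fj; exact/subsetPset/ndF/leq_maxr.
  by move: Gi; exact/subsetPset/ndG/leq_maxl.
move=> i; have [mF Fi] := Foo i; have [mG Gi] := Goo i; split.
  apply: measurableI.
    by rewrite -[X in measurable X]setTI; exact: measurable_tinit.
  by rewrite -[X in measurable X]setTI; exact: measurable_tnth.
rewrite /= /pushforward [X in (_ \x _) X](_ : _ = F i `*` G i).
  by rewrite product_measure1E// lte_mul_pinfty// ge0_fin_numE.
by apply/seteqP; split => -[t a] /=; rewrite tinit_trcons tnth_trcons_last.
Qed.

HB.instance Definition _ n :=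
  Measure_isSigmaFinite.Build _ _ _ (mupow mu n) (sigma_finite_mupow n).

Lemma integral_mupow0 (F : 0.-tuple Y -> \bar R) :
  measurable_fun setT F -> \int[mupow mu 0]_y F y = F [tuple].
Proof. by move=> mF; rewrite integral_dirac// diracT mul1e. Qed.

(** Tonelli's theorem for the product of [mu^n] and [mu], transported along the pushforward by
    [trcons]. *)
Lemma integral_mupowS n (F : n.+1.-tuple Y -> \bar R) :
  measurable_fun setT F -> (forall y, 0 <= F y) ->
  \int[mupow mu n.+1]_y F y =
  \int[mupow mu n]_y \int[mu]_z F (trcons y z).
Proof.
move=> mF F0 /=.
rewrite ge0_integral_pushforward//; last exact: measurable_trcons.
rewrite preimage_setT fubini_tonelli1//; last by move=> x; exact: F0.
by apply: measurableT_comp => //; exact: measurable_trcons.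
Qed.

Lemma measurable_integral_trcons n (F : n.+1.-tuple Y -> \bar R) :
  measurable_fun setT F -> (forall y, 0 <= F y) ->
  measurable_fun setT (fun y : n.-tuple Y => \int[mu]_z F (trcons y z)).
Proof.
move=> mF F0.
apply: (@measurable_fun_fubini_tonelli_F _ _ _ _ _ mu
  (fun p : n.-tuple Y * Y => F (trcons p.1 p.2))) => //.
by apply: measurableT_comp => //; exact: measurable_trcons.
Qed.

End mupow.

(** * Histories *)

Section hist.
Context dX dY (X : measurableType dX) (Y : measurableType dY) (R : realType).

Lemma hist_init_rcons n (h : hist X Y n) x y :
  hist_init (hist_rcons h x y) = h.
Proof. by case: h => a b; rewrite /hist_init /hist_rcons /= !tinit_trcons. Qed.

Lemma measurable_hist_init n :
  measurable_fun setT (@hist_init _ _ X Y n).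
Proof.
apply/measurable_fun_pair; apply: measurableT_comp => //;
  exact: measurable_tinit.
Qed.

Lemma measurable_hist_rcons n (h : hist X Y n) x :
  measurable_fun setT (hist_rcons h x).
Proof. by apply/measurable_fun_pair => //=; exact: measurable_fun_trcons. Qed.

Lemma run_trcons (chi : control X Y) n (y : n.-tuple Y) z :
  run chi (trcons y z) = hist_rcons (run chi y) (chi n (run chi y)) z.
Proof. by rewrite /run /hist_rcons /= tinit_trcons. Qed.

Lemma measurable_controls (chi : control X Y) n :
  control_policy chi -> measurable_fun setT (@controls _ _ X Y chi n).
Proof.
move=> mchi; elim: n => [|n IH]; first exact: measurable_cst.
have mi : measurable_fun setT (fun y : n.+1.-tuple Y => controls chi (tinit y)).
  by apply: measurableT_comp => //; exact: measurable_tinit.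
apply: measurable_fun_trcons => //=.
apply: (measurableT_comp (mchi n)); apply/measurable_fun_pair => //.
exact: measurable_tinit.
Qed.

Lemma measurable_run (chi : control X Y) n :
  control_policy chi -> measurable_fun setT (@run _ _ X Y chi n).
Proof.
by move=> mchi; apply/measurable_fun_pair => //; exact: measurable_controls.
Qed.

Lemma continue_ge0_le1 (psi : stopping X Y R) n (h : hist X Y n) :
  stopping_rule psi -> 0 <= continue psi h <= 1.
Proof.
move=> hpsi; elim: n h => [|n IH] h /=; first by rewrite ler01 lexx.
have /andP[c0 c1] := IH (hist_init h).
have /andP[p0 p1] := (hpsi n).2 h.
by rewrite mulr_ge0 ?subr_ge0//= mulr_ile1 ?subr_ge0// gerBl.
Qed.

Lemma continue_ge0 (psi : stopping X Y R) n (h : hist X Y n) :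
  stopping_rule psi -> 0 <= continue psi h.
Proof. by move=> /continue_ge0_le1 => /(_ n h) /andP[]. Qed.

Lemma measurable_continue (psi : stopping X Y R) n :
  stopping_rule psi -> measurable_fun setT (@continue _ _ X Y R psi n).
Proof.
move=> hpsi; elim: n => [|n IH] /=; first exact: measurable_cst.
apply: measurable_funM.
  by apply: measurableT_comp => //; exact: measurable_hist_init.
by apply: measurable_funB => //; exact: (hpsi n).1.
Qed.

Lemma continue_split (psi : stopping X Y R) n (h : hist X Y n.+1) :
  continue psi (hist_init h) = stop_at psi h + continue psi h.
Proof. by rewrite /stop_at /=; ring. Qed.

Lemma stop_at_ge0 (psi : stopping X Y R) n (h : hist X Y n.+1) :
  stopping_rule psi -> 0 <= stop_at psi h.
Proof.
by move=> hpsi; rewrite mulr_ge0 ?continue_ge0//; have /andP[] := (hpsi n).2 h.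
Qed.

Lemma measurable_stop_at (psi : stopping X Y R) n :
  stopping_rule psi -> measurable_fun setT (@stop_at _ _ X Y R psi n).
Proof.
move=> hpsi; apply: measurable_funM; last exact: (hpsi n).1.
apply: measurableT_comp; first exact: measurable_continue.
exact: measurable_hist_init.
Qed.

End hist.

(** * The functions V_n and R_n *)

Section bellman.
Context dX dY (X : measurableType dX) (Y : measurableType dY) (R : realType).
Variable mu : {sigma_finite_measure set Y -> \bar R}.
Context (k : nat) (f : 'I_k -> X * Y -> R).
Hypothesis hf : density_family mu f.
Local Open Scope ereal_scope.

Let f_ge0 i xy : (0 <= f i xy)%R. Proof. by have [_ + _] := hf i; exact. Qed.

Lemma joint_density_ge0 i n (h : hist X Y n) : (0 <= joint_density f i h)%R.
Proof. by apply: prodr_ge0. Qed.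

Lemma joint_density_rcons i n (h : hist X Y n) x y :
  joint_density f i (hist_rcons h x y) = (joint_density f i h * f i (x, y))%R.
Proof.
rewrite /joint_density big_ord_recr /= !tnth_trcons_last; congr (_ * _)%R.
by apply: eq_bigr => m _; rewrite !tnth_trcons_widen.
Qed.

Lemma measurable_joint_density i n :
  measurable_fun setT (fun h : hist X Y n => joint_density f i h).
Proof.
apply: measurable_prod => m _ /=; have [mf _ _] := hf i.
apply: (measurableT_comp (f := f i)
  (g := fun h : hist X Y n => (tnth h.1 m, tnth h.2 m)) mf).
apply/measurable_fun_pair.
  exact: (measurableT_comp (measurable_tnth m) measurable_fst).
exact: (measurableT_comp (measurable_tnth m) measurable_snd).
Qed.

(** The last density factor integrates to 1 whatever control is applied, so the factor of the past
    comes out unchanged. *)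
Lemma integral_joint_density i n (h : hist X Y n) x :
  integral_next mu (fun g => (joint_density f i g)%:E) h x =
  (joint_density f i h)%:E.
Proof.
rewrite /integral_next; under eq_integral do rewrite joint_density_rcons EFinM.
have [mf _ int1] := hf i.
rewrite ge0_integralZl_EFin ?joint_density_ge0//.
- by rewrite int1 mule1.
- by move=> y _; rewrite lee_fin.
- by apply/measurable_EFinP; exact: (measurableT_comp mf).
Qed.

Variables (i1 : 'I_k) (lambda : 'I_k -> 'I_k -> R).
Hypothesis lambda_ge0 : forall i j, (0 <= lambda i j)%R.

Lemma decision_lossE n j (h : hist X Y n) : decision_loss f lambda j h =
  (\sum_(i < k) if i != j then lambda i j * joint_density f i h else 0)%R.
Proof. exact: big_mkcond. Qed.

Lemma decision_loss_ge0 n j (h : hist X Y n) :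
  (0 <= decision_loss f lambda j h)%R.
Proof. by apply: sumr_ge0 => i _; rewrite mulr_ge0 ?joint_density_ge0. Qed.

Lemma measurable_decision_loss n j :
  measurable_fun setT (fun h : hist X Y n => decision_loss f lambda j h).
Proof.
under eq_fun do rewrite decision_lossE.
apply: measurable_sum => i; case: (i != j) => //.
by apply: measurable_funM => //; exact: measurable_joint_density.
Qed.

(** Linearity reduces this to the densities. It supplies the finite bounds for the integrals of [l]
    and [V]. *)
Lemma integral_decision_loss j n (h : hist X Y n) x :
  integral_next mu (fun g => (decision_loss f lambda j g)%:E) h x =
  (decision_loss f lambda j h)%:E.
Proof.
rewrite /integral_next.
under eq_integral do rewrite decision_lossE -sumEFin.
rewrite ge0_integral_sum//.
- rewrite decision_lossE -sumEFin; apply: eq_bigr => i _.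
  case: (i != j); last by rewrite integral0.
  under eq_integral do rewrite EFinM.
  rewrite ge0_integralZl_EFin//.
  + by rewrite [X in _ * X]integral_joint_density.
  + by move=> y _; rewrite lee_fin joint_density_ge0.
  + apply/measurable_EFinP; apply: measurableT_comp.
      exact: measurable_joint_density.
    exact: measurable_hist_rcons.
- move=> i; case: (i != j) => //; apply/measurable_EFinP.
  apply: measurable_funM => //; apply: measurableT_comp.
    exact: measurable_joint_density.
  exact: measurable_hist_rcons.
- move=> i y _; case: ifP => // _.
  by rewrite lee_fin mulr_ge0 ?joint_density_ge0.
Qed.

Lemma lfun_le n j (h : hist X Y n) :
  lfun f lambda h <= (decision_loss f lambda j h)%:E.
Proof. by rewrite /lfun (bigD1 j)//= ge_min lexx. Qed.

Lemma lfun_attained n (h : hist X Y n) :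
  exists j, lfun f lambda h = (decision_loss f lambda j h)%:E.
Proof.
(* The index [i1] witnesses that ['I_k] is nonempty, so the minimum is attained and is not merely
   its default [+oo]. *)
have [j _ Hj] := @eq_bigmin _ (\bar R) _ +oo i1 xpredT
  (fun j => (decision_loss f lambda j h)%:E) erefl (fun _ _ => leey _).
by exists j; rewrite -Hj.
Qed.

Lemma lfun_ge0 n (h : hist X Y n) : 0 <= lfun f lambda h.
Proof.
by have [j ->] := lfun_attained h; rewrite lee_fin decision_loss_ge0.
Qed.

Lemma measurable_lfun n :
  measurable_fun setT (fun h : hist X Y n => lfun f lambda h).
Proof.
rewrite /lfun; elim: (index_enum _) => [|j s IH].
  by under eq_fun do rewrite big_nil; exact: measurable_cst.
under eq_fun do rewrite big_cons; apply: measurable_mine => //.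
by apply/measurable_EFinP; exact: measurable_decision_loss.
Qed.

Lemma min_control_ge0 n (F : hist X Y n.+1 -> \bar R) h :
  (forall g, 0 <= F g) -> 0 <= min_control mu F h.
Proof.
by move=> F0; apply: le_ereal_inf_tmp => _ [x _ <-]; apply: integral_ge0.
Qed.

Lemma min_control_le n (F : hist X Y n.+1 -> \bar R) h x :
  min_control mu F h <= integral_next mu F h x.
Proof. by apply: ereal_inf_lbound; exists x. Qed.

Lemma integral_next_mono n (F G : hist X Y n.+1 -> \bar R) h x :
  measurable_fun setT F -> measurable_fun setT G ->
  (forall g, 0 <= F g) -> (forall g, F g <= G g) ->
  integral_next mu F h x <= integral_next mu G h x.
Proof.
move=> mF mG F0 FG; apply: ge0_le_integral => //.
- by apply: measurableT_comp => //; exact: measurable_hist_rcons.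
- by apply: measurableT_comp => //; exact: measurable_hist_rcons.
Qed.

Lemma min_control_mono n (F G : hist X Y n.+1 -> \bar R) h :
  measurable_fun setT F -> measurable_fun setT G ->
  (forall g, 0 <= F g) -> (forall g, F g <= G g) ->
  min_control mu F h <= min_control mu G h.
Proof.
move=> mF mG F0 FG; apply: le_ereal_inf_tmp => _ [x _ <-].
by apply: le_trans (integral_next_mono _ _ mF mG F0 FG); exact: min_control_le.
Qed.

Notation V N := (VN mu f i1 lambda N).
Notation l := (lfun f lambda).

Lemma VN_ge0 N n (h : hist X Y n) : 0 <= V N h.
Proof.
rewrite /VN; move: (N - n)%N => s; elim: s n h => [|s IH] n h /=.
  exact: lfun_ge0.
rewrite le_min lfun_ge0 adde_ge0 ?lee_fin ?joint_density_ge0//.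
exact: min_control_ge0.
Qed.

Lemma VN_le_lfun N n (h : hist X Y n) : V N h <= l h.
Proof. by rewrite /VN; case: (N - n)%N => [//|s] /=; rewrite ge_min lexx. Qed.

Lemma VN_geq N n (h : hist X Y n) : (N <= n)%N -> V N h = l h.
Proof. by rewrite -subn_eq0 /VN => /eqP ->. Qed.

Hypothesis hmin : minima_defined mu f i1 lambda.

Lemma measurable_VN N n : measurable_fun setT (fun h : hist X Y n.+1 => V N h).
Proof.
have [Nn|nN] := leqP N n.+1.
  by under eq_fun do rewrite (VN_geq _ Nn); exact: measurable_lfun.
under eq_fun do rewrite (VN_rec _ _ _ _ _ nN).
apply: measurable_mine; first exact: measurable_lfun.
apply: emeasurable_funD.
  by apply/measurable_EFinP; exact: measurable_joint_density.
have /(_ nN)[] // := hmin.1 N n.+1.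
Qed.

(** At the horizon, the longer truncation is a minimum that includes [l]; monotonicity of
    [min_control] carries this back through the recursion. For [N] up to the stage itself, truncated
    subtraction makes [VN] equal to [l]. *)
Lemma VN_nonincreasing n (h : hist X Y n.+1) :
  nonincreasing_seq (fun N => V N h).
Proof.
apply/nonincreasing_seqP => N; case: (leqP N n.+1) => [Nn|nN].
  by rewrite (VN_geq _ Nn) VN_le_lfun.
(* Induction on the gap, general in the stage: unfolding the recursion once moves from stage [n.+1]
   to [n.+2] with the horizon fixed. *)
move: nN; move E : (N - n)%N => s; elim: s n h E => [|s IH] n h E nN; first lia.
rewrite (VN_rec _ _ _ _ _ nN) (VN_rec _ _ _ _ _ (leqW nN)).
apply: le_min2 => //; apply: leeD2l.
apply: min_control_mono => [||g|g].
- exact: measurable_VN.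
- exact: measurable_VN.
- exact: VN_ge0.
- have [Nn2|nN2] := leqP N n.+2; first by rewrite (VN_geq _ Nn2) VN_le_lfun.
  by apply: IH => //; lia.
Qed.

End bellman.

(** * The limit of the truncated values and the optimality equation *)

Section bellman_limit.
Context dX dY (X : measurableType dX) (Y : measurableType dY) (R : realType).
Variable mu : {sigma_finite_measure set Y -> \bar R}.
Context (k : nat) (f : 'I_k -> X * Y -> R).
Hypothesis hf : density_family mu f.
Variables (i1 : 'I_k) (lambda : 'I_k -> 'I_k -> R).
Hypothesis lambda_ge0 : forall i j, 0 <= lambda i j.
Hypothesis hmin : minima_defined mu f i1 lambda.
Local Open Scope ereal_scope.

Local Notation V N := (@VN _ _ X Y R mu k f i1 lambda N _).
Local Notation Vl := (@Vlim _ _ X Y R mu k f i1 lambda _).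
Local Notation Rl := (Rlim mu f i1 lambda).
Local Notation l := (lfun f lambda).
Local Notation f1 := (joint_density f i1).

Lemma VN_cvg n (h : hist X Y n.+1) : V N h @[N --> \oo] --> Vl h.
Proof. exact/ereal_nonincreasing_is_cvgn/VN_nonincreasing. Qed.

Lemma Vlim_inf n (h : hist X Y n.+1) :
  Vl h = ereal_inf (range (fun N => V N h)).
Proof. exact/cvg_lim/ereal_nonincreasing_cvgn/VN_nonincreasing. Qed.

Lemma Vlim_le_VN N n (h : hist X Y n.+1) : Vl h <= V N h.
Proof. by rewrite Vlim_inf; apply: ereal_inf_lbound; exists N. Qed.

Lemma le_Vlim n (h : hist X Y n.+1) a : (forall N, a <= V N h) -> a <= Vl h.
Proof.
by move=> aV; rewrite Vlim_inf; apply: le_ereal_inf_tmp => _ [N _ <-].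
Qed.

Lemma Vlim_ge0 n (h : hist X Y n.+1) : 0 <= Vl h.
Proof. by apply: le_Vlim => N; exact: VN_ge0. Qed.

Lemma measurable_Vlim n : measurable_fun setT (fun h : hist X Y n.+1 => Vl h).
Proof.
apply: (emeasurable_fun_cvg (fun N h => V N h)) => [N|h _].
  exact: measurable_VN.
exact: VN_cvg.
Qed.

Lemma measurable_Rlim n : measurable_fun setT (fun h : hist X Y n => Rl h).
Proof. by have [] := hmin.2 n. Qed.

Lemma Rlim_ge0 n (h : hist X Y n) : 0 <= Rl h.
Proof. by apply: min_control_ge0 => g; exact: Vlim_ge0. Qed.

(** [l] lies below the loss of accepting hypothesis [i1], whose integral over the next observation
    is finite. *)
Lemma integrable_lfun_next n (h : hist X Y n) x :
  mu.-integrable setT (fun y => l (hist_rcons h x y)).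
Proof.
have mr := measurable_hist_rcons h x.
apply/integrableP; split.
  by apply: measurableT_comp => //; exact: measurable_lfun.
rewrite (eq_integral (fun y => l (hist_rcons h x y))); last first.
  by move=> y _; rewrite gee0_abs// (lfun_ge0 hf i1 lambda_ge0).
apply: (@le_lt_trans _ _ (decision_loss f lambda i1 h)%:E); last exact: ltry.
rewrite -(integral_decision_loss hf lambda_ge0 i1 h x).
apply: integral_next_mono => [||g|g].
- exact: measurable_lfun.
- by apply/measurable_EFinP; exact: measurable_decision_loss.
- exact: lfun_ge0.
- exact: lfun_le.
Qed.

(** Dominated convergence, with the integrable majorant [l]. *)
Lemma integral_next_VN_cvg n (h : hist X Y n) x :
  integral_next mu (V N) h x @[N --> \oo] --> integral_next mu (Vl) h x.
Proof.
have mr := measurable_hist_rcons h x.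
apply: (@dominated_cvg _ _ _ mu setT measurableT
  (fun N y => V N (hist_rcons h x y)) _ (fun y => l (hist_rcons h x y))).
- by move=> N; apply: measurableT_comp => //; exact: measurable_VN.
- by move=> y _; exact: VN_cvg.
- move=> y _; have [j ->] := lfun_attained f i1 lambda (hist_rcons h x y).
  by [].
- exact: integrable_lfun_next.
- by move=> N y _; rewrite gee0_abs ?VN_ge0// VN_le_lfun.
Qed.

(** The recursion survives the limit. Upper bound: fix a control, pass to the limit under the
    integral, then take the infimum over controls. Lower bound: [V <= V^N] gives [R <= R^N] by
    monotonicity. *)
Lemma VlimE n (h : hist X Y n.+1) : Vl h = mine (l h) ((f1 h)%:E + Rl h).
Proof.
apply/eqP; rewrite eq_le; apply/andP; split.
  rewrite le_min; apply/andP; split.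
    by apply: le_trans (VN_le_lfun mu f i1 lambda 0 h); exact: Vlim_le_VN.
  rewrite -leeBlDl//; apply: le_ereal_inf_tmp => _ [x _ <-]; rewrite leeBlDl//.
  have cD : (f1 h)%:E + integral_next mu (V N) h x @[N --> \oo] -->
      (f1 h)%:E + integral_next mu (Vl) h x.
    apply: cvgeD; [|exact: cvg_cst|exact: integral_next_VN_cvg].
    exact: fin_num_adde_defr.
  rewrite -(cvg_lim _ cD)//.
  apply: lime_ge; first by apply/cvg_ex; eexists; exact: cD.
  (* As [h] has length [n.+1], the recursion for [V^N] at [h] applies from [N = n.+2] on. *)
  exists n.+2 => // N /= nN; apply: le_trans (Vlim_le_VN N h) _.
  rewrite (VN_rec _ _ _ _ _ nN) ge_min; apply/orP; right.
  exact/leeD2l/min_control_le.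
apply: le_Vlim => N; have [Nn|nN] := leqP N n.+1.
  by rewrite (VN_geq _ _ _ _ _ Nn) ge_min lexx.
rewrite (VN_rec _ _ _ _ _ nN); apply: le_min2 => //; apply/leeD2l.
apply: min_control_mono => [||g|g].
- exact: measurable_Vlim.
- exact: measurable_VN.
- exact: Vlim_ge0.
- exact: Vlim_le_VN.
Qed.

Lemma Vlim_le_lfun n (h : hist X Y n.+1) : Vl h <= l h.
Proof. by rewrite VlimE ge_min lexx. Qed.

(** The infimum is at most its value at [x], where [V] is bounded by the loss of [j], and that loss
    keeps its value under integration. Hence [R] is finite once some control is at hand. *)
Lemma Rlim_le_loss n (h : hist X Y n) (x : X) j :
  Rl h <= (decision_loss f lambda j h)%:E.
Proof.
apply: le_trans (min_control_le _ _ _ x) _.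
rewrite -(integral_decision_loss hf lambda_ge0 j h x).
apply: integral_next_mono => [||g|g].
- exact: measurable_Vlim.
- by apply/measurable_EFinP; exact: measurable_decision_loss.
- exact: Vlim_ge0.
- by apply: le_trans (Vlim_le_lfun g) _; exact: lfun_le.
Qed.

Lemma Rlim_fin_num n (h : hist X Y n) (x : X) : Rl h \is a fin_num.
Proof.
rewrite ge0_fin_numE ?Rlim_ge0//.
by apply: le_lt_trans (Rlim_le_loss h x i1) _; exact: ltry.
Qed.

End bellman_limit.

(** * Telescoping inequalities *)

Section telescoping.
Context (R : realType).
Local Open Scope ereal_scope.
Implicit Types r v a : (\bar R)^nat.

Lemma telescoping_cvg r a n : (forall m, 0 <= a m) -> r @ \oo --> 0 ->
  \sum_(n <= m < N) a m + r N @[N --> \oo] --> \sum_(n <= m <oo) a m.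
Proof.
move=> a0 r0; rewrite -[X in _ --> X]adde0; apply: cvgeD => //.
  by rewrite fin_num_adde_defl.
by apply: is_cvg_nneseries => m _ _.
Qed.

(** Iteration gives [r n <= \sum_(n <= m < N) a m + r N], and the remainder vanishes in the
    limit. *)
Lemma telescoping_le r a n : (forall m, 0 <= a m) ->
  (forall m, r m <= a m + r m.+1) -> r @ \oo --> 0 ->
  r n <= \sum_(n <= m <oo) a m.
Proof.
move=> a0 ra r0; have cD := telescoping_cvg (n := n) a0 r0.
rewrite -(cvg_lim _ cD)//; apply: lime_ge.
  by apply/cvg_ex; eexists; exact: cD.
exists n => // N /=; elim: N => [|N IH].
  by rewrite leqn0 => /eqP ->; rewrite big_geq// add0e.
rewrite leq_eqVlt => /predU1P[->|nN]; first by rewrite big_geq// add0e.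
rewrite big_nat_recr//= -addeA; apply: le_trans (IH nN) _; exact: leeD2l.
Qed.

Lemma telescoping_eq r a n : (forall m, 0 <= a m) ->
  (forall m, r m = a m + r m.+1) -> r @ \oo --> 0 ->
  r n = \sum_(n <= m <oo) a m.
Proof.
move=> a0 ra r0; have cD := telescoping_cvg (n := n) a0 r0.
rewrite -(cvg_lim _ cD)//; apply/esym/lim_near_cst => //.
exists n => // N /=; elim: N => [|N IH].
  by rewrite leqn0 => /eqP ->; rewrite big_geq// add0e.
rewrite leq_eqVlt => /predU1P[->|nN]; first by rewrite big_geq// add0e.
by rewrite big_nat_recr//= -addeA -ra IH.
Qed.

(** Each [r n] is at most the tail sum of [a] from [n]. Equality at 0 propagates to every [n], and
    then [v n] is squeezed between two equal terms. *)
Lemma telescoping_rigid r v a : (forall m, 0 <= a m) ->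
  (forall m, r m <= v m) -> (forall m, v m <= a m + r m.+1) ->
  r @ \oo --> 0 -> \sum_(m <oo) a m <= r 0%N -> r 0%N < +oo ->
  forall n, r n = v n /\ v n = a n + r n.+1 /\ r n < +oo.
Proof.
move=> a0 rv va r0 ar0 r0oo.
have ra m : r m <= a m + r m.+1 by exact: le_trans (rv m) (va m).
have rT n : r n <= \sum_(n <= m <oo) a m by exact: telescoping_le.
have TS n : \sum_(n <= m <oo) a m = a n + \sum_(n.+1 <= m <oo) a m.
  by rewrite (nneseries_split n 1)// addn1 big_nat1.
suff rTn n : r n = \sum_(n <= m <oo) a m /\ r n < +oo.
  move=> n; have [En noo] := rTn n; have [ES Soo] := rTn n.+1.
  have E : a n + r n.+1 = r n by rewrite ES -TS -En.
  split.
    by apply/eqP; rewrite eq_le rv/= -E va.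
  split=> //; apply/eqP; rewrite eq_le va /= E; exact: rv.
elim: n => [|n [IH noo]].
  by split => //; apply/eqP; rewrite eq_le rT.
have E : r n = a n + \sum_(n.+1 <= m <oo) a m by rewrite IH TS.
have Eoo : a n + \sum_(n.+1 <= m <oo) a m < +oo by rewrite -E.
(* Finiteness of [a n] allows it to be cancelled when its sum with the next tail is compared with
   [a n + r n.+1]. *)
have afin : a n \is a fin_num.
  rewrite ge0_fin_numE//; apply: le_lt_trans Eoo; rewrite leeDl//.
  by apply: nneseries_ge0.
have Too : \sum_(n.+1 <= m <oo) a m < +oo.
  by apply: le_lt_trans Eoo; rewrite leeDr.
split; last exact: le_lt_trans (rT _) Too.
apply/eqP; rewrite eq_le rT /=.
by rewrite -(leeD2lE _ _ afin) -E.
Qed.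

(** The tail-sum formula for an expectation: after interchanging the sums, [a n] occurs once for
    each [m <= n], that is [n.+1] times. *)
Lemma nneseries_tail_sum (a : (\bar R)^nat) : (forall n, 0 <= a n) ->
  \sum_(n <oo) n.+1%:R%:E * a n = \sum_(m <oo) \sum_(m <= n <oo) a n.
Proof.
move=> a0.
transitivity (\sum_(m <oo) \sum_(n <oo) (if (m <= n)%N then a n else 0)).
  rewrite nneseries_interchange; last by move=> i j; case: ifP.
  apply: eq_eseriesr => n _.
  rewrite (nneseries_split 0 n.+1); last by move=> m _; case: ifP.
  rewrite add0n [X in _ + X]eseries0; last by move=> m nm _; rewrite leqNgt nm.
  rewrite adde0 (eq_big_nat _ _ (F2 := fun=> a n)); last first.
    by move=> m /andP[_ mn]; rewrite -ltnS mn.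
  by rewrite big_const_nat subn0 iter_addr_0 mule_natl.
apply: eq_eseriesr => m _.
rewrite [RHS]eseries_cond [RHS]eseries_mkcond; apply: eq_eseriesr => n _.
by rewrite andTb.
Qed.

End telescoping.

(** * Equality cases for integrals and for mixtures *)

Section integral_ae.
Context d (T : measurableType d) (R : realType).
Variable m : {measure set T -> \bar R}.
Local Open Scope ereal_scope.

(** Since the common integral is finite, the nonnegative difference [G - F] integrates to 0 and so
    vanishes almost everywhere. *)
Lemma ge0_integral_eq_ae (F G : T -> \bar R) :
  measurable_fun setT F -> measurable_fun setT G ->
  (forall x, 0 <= F x) -> (forall x, F x \is a fin_num) ->
  (forall x, F x <= G x) -> \int[m]_x F x < +oo ->
  \int[m]_x F x = \int[m]_x G x -> {ae m, forall x, F x = G x}.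
Proof.
move=> mF mG F0 Ff FG Foo FGE.
have mD : measurable_fun setT (fun x => G x - F x) by exact: emeasurable_funB.
have D0 x : 0 <= G x - F x by rewrite sube_ge0// Ff.
have : \int[m]_x `|G x - F x| = 0.
  under eq_integral do rewrite gee0_abs//.
  have : \int[m]_x G x = \int[m]_x F x + \int[m]_x (G x - F x).
    rewrite -ge0_integralD//; apply: eq_integral => x _.
    by rewrite addeC subeK.
  have Fi : \int[m]_x F x \is a fin_num by rewrite ge0_fin_numE// integral_ge0.
  by rewrite -FGE addeC => E; rewrite -[LHS](addeK _ Fi) -E subee.
move/(ae_eq_integral_abs m measurableT mD); apply: filterS => x /(_ I) /= E.
by rewrite -[RHS](subeK _ (Ff x)) E add0e.
Qed.

End integral_ae.

(** Condition (a) for real numbers. Up to the factor [c], the mixture exceeds the minimum by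
    [(1 - p) * (b - a)] if [a < b] and by [p * (a - b)] if [b < a]; in a tie every [p] is
    allowed. *)
Lemma mix_eq_min (R : realFieldType) (c p a b : R) : 0 < c -> 0 <= p <= 1 ->
  c * Num.min a b = c * p * a + c * (1 - p) * b <->
  (a < b)%R%:R <= p <= (a <= b)%R%:R.
Proof.
move=> c0 p01; have cn0 : c != 0 by rewrite gt_eqF.
have -> : c * p * a + c * (1 - p) * b = c * (p * a + (1 - p) * b) by ring.
case: (ltgtP a b) => [ab|ba|<-] /=.
- split=> [/(mulfI cn0) /eqP|/andP[p1 p1']].
    rewrite -subr_eq0 (_ : _ - _ = (1 - p) * (a - b)); last by ring.
    rewrite mulf_eq0 (subr_eq0 a) (lt_eqF ab) orbF subr_eq0 => /eqP <-.
    by rewrite lexx.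
  have -> : p = 1 by apply/eqP; rewrite eq_le p1 p1'.
  by congr (_ * _); ring.
- split=> [/(mulfI cn0) /eqP|/andP[p1 p1']].
    rewrite -subr_eq0 (_ : _ - _ = p * (b - a)); last by ring.
    rewrite mulf_eq0 (subr_eq0 b) (lt_eqF ba) orbF => /eqP ->.
    by rewrite lexx.
  have -> : p = 0 by apply/eqP; rewrite eq_le p1 p1'.
  by congr (_ * _); ring.
- by split => // _; congr (_ * _); ring.
Qed.

Lemma min_le_mix (R : realFieldType) (c p a b : R) : 0 <= c -> 0 <= p <= 1 ->
  c * Num.min a b <= c * p * a + c * (1 - p) * b.
Proof.
move=> c0 /andP[p0 p1].
have -> : c * p * a + c * (1 - p) * b = c * (p * a + (1 - p) * b) by ring.
apply: ler_wpM2l => //.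
have -> : Num.min a b = p * Num.min a b + (1 - p) * Num.min a b by ring.
by apply: lerD; apply: ler_wpM2l; rewrite ?subr_ge0// ge_min lexx ?orbT.
Qed.

Lemma indic_bool (R : pzRingType) (T : Type) (P : pred T) t :
  \1_[set x | P x] t = (P t)%:R :> R.
Proof.
by rewrite indicE (_ : (t \in _) = P t)//; apply/idP/idP; rewrite inE.
Qed.

(** * The cost of a strategy *)

Section strategy.
Context dX dY (X : measurableType dX) (Y : measurableType dY) (R : realType).
Variable mu : {sigma_finite_measure set Y -> \bar R}.
Context (k : nat) (f : 'I_k -> X * Y -> R).
Hypothesis hf : density_family mu f.
Variables (i1 : 'I_k) (lambda : 'I_k -> 'I_k -> R).
Hypothesis lambda_ge0 : forall i j, 0 <= lambda i j.
Hypothesis hmin : minima_defined mu f i1 lambda.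
Variables (chi : control X Y) (psi : stopping X Y R).
Hypotheses (hchi : control_policy chi) (hpsi : stopping_rule psi).
Local Open Scope ereal_scope.

Local Notation Vl := (@Vlim _ _ X Y R mu k f i1 lambda _).
Local Notation Rl := (@Rlim _ _ X Y R mu k f i1 lambda _).
Local Notation l := (@lfun _ _ X Y R k f lambda _).
Local Notation f1 := (@joint_density _ _ X Y R k f i1 _).
Local Notation c := (@continue _ _ X Y R psi _).
Local Notation cn n := (@continue _ _ X Y R psi n).

(** No density factor is inserted, because [l], [V] and [R] already contain the joint densities. *)
Definition run_integral n (G : hist X Y n -> \bar R) : \bar R :=
  \int[mupow mu n]_y G (run chi y).

(** The weight ignores the last stage and the last control is [chi] at the current history, so the
    last observation can be integrated out first. *)
Lemma run_integral_next n (w : hist X Y n -> R) (G : hist X Y n.+1 -> \bar R) :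
  measurable_fun setT w -> (forall h, (0 <= w h)%R) ->
  measurable_fun setT G -> (forall h, 0 <= G h) ->
  run_integral (fun h => (w (hist_init h))%:E * G h) =
  run_integral (fun h => (w h)%:E * integral_next mu G h (@chi n h)).
Proof.
move=> mw w0 mG G0; rewrite /run_integral integral_mupowS.
- apply: eq_integral => y _.
  under eq_integral do rewrite run_trcons hist_init_rcons.
  rewrite ge0_integralZl_EFin//.
  by apply: measurableT_comp => //; exact: measurable_hist_rcons.
- apply: emeasurable_funM.
    apply/measurable_EFinP; apply: measurableT_comp mw _.
    apply: measurableT_comp; first exact: measurable_hist_init.
    exact: measurable_run.
  by apply: measurableT_comp => //; exact: measurable_run.
- by move=> y; rewrite mule_ge0 ?lee_fin.
Qed.

Let mc n : measurable_fun setT (cn n).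
Proof. exact: measurable_continue. Qed.

Let c0 n (h : hist X Y n) : (0 <= c h)%R.
Proof. exact: continue_ge0. Qed.

Let mrun n : measurable_fun setT (@run _ _ X Y chi n).
Proof. exact: measurable_run. Qed.

(** * Survival probabilities and the expected sample number *)

Lemma expectation_under_ge0 i n (F : hist X Y n -> R) :
  (forall h, 0 <= F h)%R -> 0 <= expectation_under mu f chi i F.
Proof.
move=> F0; apply: integral_ge0 => y _.
by rewrite lee_fin mulr_ge0 ?(joint_density_ge0 hf).
Qed.

Lemma measurable_weight_run n (w : hist X Y n -> R) (G : hist X Y n -> \bar R) :
  measurable_fun setT w -> measurable_fun setT G ->
  measurable_fun setT (fun y => (w (run chi y))%:E * G (run chi y)).
Proof.
move=> mw mG; apply: emeasurable_funM; last first.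
  exact: (measurableT_comp mG (@mrun n)).
by apply/measurable_EFinP; exact: (measurableT_comp mw (@mrun n)).
Qed.

Let mf i n : measurable_fun setT
  (fun h : hist X Y n => (joint_density f i h)%:E).
Proof. by apply/measurable_EFinP; exact: (measurable_joint_density hf). Qed.

Let mstop n : measurable_fun setT (@stop_at _ _ X Y R psi n).
Proof. exact: measurable_stop_at. Qed.

Lemma expectation_underE i n (F : hist X Y n -> R) :
  expectation_under mu f chi i F =
  run_integral (fun h => (F h)%:E * (joint_density f i h)%:E).
Proof. by []. Qed.

(** Pointwise [c_n = s_(n+1) + c_(n+1)], and the density of [n.+1] observations integrates to that
    of [n]. *)
Lemma expectation_continue i n :
  expectation_under mu f chi i (cn n) =
  prob_tau mu f chi psi i n +
  expectation_under mu f chi i (cn n.+1).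
Proof.
rewrite /prob_tau !expectation_underE /run_integral.
rewrite -ge0_integralD//; last 4 first.
- move=> y _; rewrite mule_ge0 ?lee_fin ?(joint_density_ge0 hf)//.
  exact: stop_at_ge0.
- exact: (measurable_weight_run (@mstop n) (@mf i n.+1)).
- by move=> y _; rewrite mule_ge0 ?lee_fin ?(joint_density_ge0 hf).
- exact: (measurable_weight_run (@mc n.+1) (@mf i n.+1)).
transitivity (run_integral (fun h : hist X Y n.+1 =>
    (c (hist_init h))%:E * (joint_density f i h)%:E)).
  rewrite run_integral_next//.
  - by apply: eq_integral => y _; rewrite (integral_joint_density hf).
  - by move=> h; rewrite lee_fin (joint_density_ge0 hf).
apply: eq_integral => y _.
by rewrite continue_split EFinD -ge0_muleDl ?lee_fin//; exact: stop_at_ge0.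
Qed.

Lemma expectation_continue0 i :
  expectation_under mu f chi i (cn 0) = 1.
Proof.
rewrite expectation_underE /run_integral integral_mupow0; last first.
  exact: (measurable_weight_run (@mc 0) (@mf i 0)).
by rewrite /= mul1e /joint_density big_ord0.
Qed.

Hypothesis hF : forall i,
  (fun n => expectation_under mu f chi i (cn n)) @ \oo
    --> 0.

(** [prob_tau] at [m] concerns stage [m.+1], so the tail from [n] is the probability that the
    stopping time exceeds [n]; membership in the class makes the remainder vanish. *)
Lemma sum_prob_tau i n :
  expectation_under mu f chi i (cn n) =
  \sum_(n <= m <oo) prob_tau mu f chi psi i m.
Proof.
apply: (telescoping_eq (r := fun n =>
  expectation_under mu f chi i (cn n))) => // m.
  by apply: expectation_under_ge0 => h; exact: stop_at_ge0.
exact: expectation_continue.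
Qed.

(** The case [n = 0] of [sum_prob_tau] shows that stopping has probability 1, so the series branch
    of the definition applies; the tail-sum formula then turns it into survival probabilities. *)
Lemma sample_numberE : sample_number mu f i1 chi psi =
  \sum_(n <oo) expectation_under mu f chi i1 (cn n).
Proof.
rewrite /sample_number -sum_prob_tau expectation_continue0 eqxx.
rewrite nneseries_tail_sum.
  by apply: eq_eseriesr => n _; rewrite sum_prob_tau.
by move=> n; apply: expectation_under_ge0 => h; exact: stop_at_ge0.
Qed.

(** The terms of the chain [Rcost n <= Vcost n <= Scost n + Ccost n.+1 + Rcost n.+1]. Beware of the
    shift: [Vcost n] and [Scost n] live on histories of length [n.+1], weighted by reaching,
    respectively stopping at, stage [n.+1]. *)
Definition Rcost n := run_integral (fun h : hist X Y n => (c h)%:E * Rl h).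
Definition Vcost n :=
  run_integral (fun h : hist X Y n.+1 => (c (hist_init h))%:E * Vl h).
Definition Scost n :=
  run_integral (fun h : hist X Y n.+1 => (stop_at psi h)%:E * l h).
Definition Ccost n := expectation_under mu f chi i1 (cn n).

Lemma VcostE n : Vcost n =
  run_integral
    (fun h : hist X Y n => (c h)%:E * integral_next mu Vl h (@chi n h)).
Proof.
rewrite /Vcost run_integral_next//; first exact: measurable_Vlim.
by move=> h; exact: Vlim_ge0.
Qed.

Lemma integral_next_Vlim n (y : n.-tuple Y) :
  integral_next mu Vl (run chi y) (chi (run chi y)) =
  \int[mu]_z Vl (run chi (trcons y z)).
Proof. by apply: eq_integral => z _; rewrite run_trcons. Qed.

Let V0 n (h : hist X Y n.+1) : 0 <= Vl h.
Proof. exact: Vlim_ge0. Qed.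

Let mV n : measurable_fun setT (fun h : hist X Y n.+1 => Vl h).
Proof. exact: measurable_Vlim. Qed.

Let R0 n (h : hist X Y n) : 0 <= Rl h.
Proof. exact: Rlim_ge0. Qed.

Let mR n : measurable_fun setT (fun h : hist X Y n => Rl h).
Proof. exact: measurable_Rlim. Qed.

Let Rfin n (h : hist X Y n) : Rl h \is a fin_num.
Proof.
(* The policy applied to the empty history supplies the control that the finiteness bound asks
   for. *)
exact: (Rlim_fin_num hf lambda_ge0 hmin h (@chi 0%N ([tuple], [tuple]))).
Qed.

Let l0 n (h : hist X Y n) : 0 <= l h.
Proof. exact: (lfun_ge0 hf i1). Qed.

Let ml n : measurable_fun setT (fun h : hist X Y n => l h).
Proof. exact: (measurable_lfun hf). Qed.

Let stop0 n (h : hist X Y n.+1) : (0 <= stop_at psi h)%R.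
Proof. exact: stop_at_ge0. Qed.

Let f0 n (h : hist X Y n) : (0 <= f1 h)%R.
Proof. exact: joint_density_ge0. Qed.

Let mRw n : measurable_fun setT
  (fun y : n.-tuple Y => (c (run chi y))%:E * Rl (run chi y)).
Proof. exact: (measurable_weight_run (@mc n) (@mR n)). Qed.

Let mVw n : measurable_fun setT (fun y : n.-tuple Y =>
  (c (run chi y))%:E * \int[mu]_z Vl (run chi (trcons y z))).
Proof.
apply: emeasurable_funM.
  by apply/measurable_EFinP; exact: (measurableT_comp (@mc n) (@mrun n)).
apply: (measurable_integral_trcons mu (F := fun y => Vl (run chi y))) => //.
exact: (measurableT_comp (@mV n) (@mrun n.+1)).
Qed.

Lemma Vcost_integral n : Vcost n =
  \int[mupow mu n]_y
    ((c (run chi y))%:E * \int[mu]_z Vl (run chi (trcons y z))).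
Proof.
by rewrite VcostE; apply: eq_integral => y _; rewrite integral_next_Vlim.
Qed.

Lemma Rlim_le_integral n (y : n.-tuple Y) :
  Rl (run chi y) <= \int[mu]_z Vl (run chi (trcons y z)).
Proof. by rewrite -integral_next_Vlim; exact: min_control_le. Qed.

Lemma Rcost_le n : Rcost n <= Vcost n.
Proof.
rewrite Vcost_integral; apply: ge0_le_integral => //.
- by move=> y _; rewrite mule_ge0 ?lee_fin.
- exact: mRw.
- exact: mVw.
- by move=> y _; apply: lee_wpmul2l; rewrite ?lee_fin ?Rlim_le_integral.
Qed.

(** Outside [Cbar] the weight [c_n] vanishes, so the two integrands agree there as well. *)
Lemma Rcost_eq n :
  {ae mupow mu n, forall y, Cbar chi psi y ->
    \int[mu]_z Vl (run chi (trcons y z)) = Rl (run chi y)} ->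
  Rcost n = Vcost n.
Proof.
move=> H; rewrite Vcost_integral; apply: ge0_ae_eq_integral => //.
- exact: mRw.
- exact: mVw.
- by move=> y _; rewrite mule_ge0 ?lee_fin.
- by move=> y _; rewrite mule_ge0 ?lee_fin ?integral_ge0.
apply: filterS H => y /= H _.
have [cy|] := boolP (0 < c (run chi y))%R; first by rewrite H.
rewrite -leNgt => cle; have -> : c (run chi y) = 0%R.
  by apply/eqP; rewrite eq_le cle c0.
by rewrite !mul0e.
Qed.

(** Ordered integrands with equal finite integrals agree almost everywhere; on [Cbar] the positive
    weight cancels. *)
Lemma Rcost_eq_ae n : Rcost n < +oo -> Rcost n = Vcost n ->
  {ae mupow mu n, forall y, Cbar chi psi y ->
    \int[mu]_z Vl (run chi (trcons y z)) = Rl (run chi y)}.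
Proof.
rewrite Vcost_integral => Roo E.
apply: filterS (ge0_integral_eq_ae (@mRw n) (@mVw n) _ _ _ Roo E)
  => [y /= + cy|y|y|y].
- by move/eqP; rewrite eq_le !lee_pmul2l// -eq_le eq_sym => /eqP.
- by rewrite mule_ge0 ?lee_fin.
- by rewrite fin_numM.
- by apply: lee_wpmul2l; rewrite ?lee_fin ?Rlim_le_integral.
Qed.

(** This is the weight of reaching the stage times the [psi]-mixture of the stopping cost [l] and
    the continuation cost [f1 + R]. *)
Definition mix n (h : hist X Y n.+1) : \bar R :=
  (stop_at psi h)%:E * l h + (c h)%:E * ((f1 h)%:E + Rl h).

Let mmix n : measurable_fun setT (fun y => mix (@run _ _ X Y chi n.+1 y)).
Proof.
apply: emeasurable_funD.
  exact: (measurable_weight_run (@mstop n) (@ml n.+1)).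
apply: (measurable_weight_run (G := fun h => (f1 h)%:E + Rl h) (@mc n.+1)).
exact: (emeasurable_funD (@mf i1 n.+1) (@mR n.+1)).
Qed.

Lemma mix_ge0 n (h : hist X Y n.+1) : 0 <= mix h.
Proof. by rewrite !(adde_ge0, mule_ge0) ?lee_fin. Qed.

Lemma mixE n : Scost n + Ccost n.+1 + Rcost n.+1 =
  run_integral (fun h : hist X Y n.+1 => mix h).
Proof.
have mCw := measurable_weight_run (@mc n.+1) (@mf i1 n.+1).
have mSw := measurable_weight_run (@mstop n) (@ml n.+1).
have C0 (y : n.+1.-tuple Y) :
  0 <= (c (run chi y))%:E * (f1 (run chi y))%:E by rewrite mule_ge0 ?lee_fin.
have Rw0 (y : n.+1.-tuple Y) :
  0 <= (c (run chi y))%:E * Rl (run chi y) by rewrite mule_ge0 ?lee_fin.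
have S0 (y : n.+1.-tuple Y) :
    0 <= (stop_at psi (run chi y))%:E * l (run chi y).
  by rewrite mule_ge0 ?lee_fin.
rewrite /Scost /Ccost /Rcost expectation_underE -addeA /run_integral.
rewrite -(ge0_integralD _ measurableT (fun y _ => C0 y) mCw
  (fun y _ => Rw0 y) (@mRw _)).
rewrite -(ge0_integralD _ measurableT (fun y _ => S0 y) mSw).
- by apply: eq_integral => y _; rewrite /mix ge0_muleDr// lee_fin.
- by move=> y _; rewrite adde_ge0.
- exact: (emeasurable_funD mCw (@mRw _)).
Qed.

(** Both arguments of the minimum are finite, which brings the optimality equation within reach of
    the real mixture lemmas. *)
Lemma Vlim_real n (h : hist X Y n.+1) : exists a b : R,
  [/\ l h = a%:E, (f1 h)%:E + Rl h = b%:E & Vl h = (Num.min a b)%:E].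
Proof.
have [j lj] := lfun_attained f i1 lambda h.
exists (decision_loss f lambda j h), (f1 h + fine (Rl h))%R.
have Rr : (f1 h)%:E + Rl h = (f1 h + fine (Rl h))%:E by rewrite EFinD fineK.
by split=> //; rewrite (VlimE hf lambda_ge0 hmin) lj Rr EFin_min.
Qed.

Lemma Vlim_le_mix n (h : hist X Y n.+1) : (c (hist_init h))%:E * Vl h <= mix h.
Proof.
have [a [b [la Rb ->]]] := Vlim_real h; rewrite /mix la Rb.
by rewrite -!EFinM -EFinD lee_fin min_le_mix//; exact: (hpsi n).2.
Qed.

Lemma Vlim_eq_mix n (h : hist X Y n.+1) : (0 < c (hist_init h))%R ->
  (c (hist_init h))%:E * Vl h = mix h <->
  (\1_[set g : hist X Y n.+1 | (l g < (f1 g)%:E + Rl g)%E] h <= psi h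
     <= \1_[set g : hist X Y n.+1 | (l g <= (f1 g)%:E + Rl g)%E] h)%R.
Proof.
move=> cpos; have [a [b [la Rb ->]]] := Vlim_real h; rewrite /mix.
rewrite !indic_bool la Rb lee_fin lte_fin.
rewrite -(mix_eq_min a b cpos ((hpsi n).2 h)) -!EFinM -EFinD.
by split=> [[]|->].
Qed.

Let mVc n : measurable_fun setT (fun y : n.+1.-tuple Y =>
  (c (hist_init (run chi y)))%:E * Vl (run chi y)).
Proof.
apply: (measurable_weight_run (w := fun h => c (hist_init h)) _ (@mV n)).
apply: measurableT_comp; first exact: mc.
exact: measurable_hist_init.
Qed.

Let Vc0 n (y : n.+1.-tuple Y) : setT y ->
  0 <= (c (hist_init (run chi y)))%:E * Vl (run chi y).
Proof. by move=> _; rewrite mule_ge0 ?lee_fin. Qed.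

Lemma Vcost_le n : Vcost n <= Scost n + Ccost n.+1 + Rcost n.+1.
Proof.
rewrite mixE; apply: ge0_le_integral => //.
- exact: Vc0.
- exact: mVc.
- exact: mmix.
- by move=> y _; exact: Vlim_le_mix.
Qed.

(** On [Cset], condition (a) is the equality case of the mixture bound. Elsewhere the weight of
    reaching the stage is 0, and both integrands vanish. *)
Lemma Vcost_eq n :
  {ae mupow mu n.+1, forall y, Cset chi psi y ->
    (\1_[set h : hist X Y n.+1 | (l h < (f1 h)%:E + Rl h)%E] (run chi y)
       <= psi (run chi y)
     <= \1_[set h : hist X Y n.+1 | (l h <= (f1 h)%:E + Rl h)%E]
          (run chi y))%R}
  -> Vcost n = Scost n + Ccost n.+1 + Rcost n.+1.
Proof.
move=> H; rewrite mixE; apply: ge0_ae_eq_integral => //.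
- exact: mVc.
- exact: mmix.
- exact: Vc0.
- by move=> y _; exact: mix_ge0.
apply: filterS H => y /= H _.
have [cy|] := boolP (0 < c (hist_init (run chi y)))%R.
  exact/(Vlim_eq_mix cy)/H.
rewrite -leNgt => cle.
have ci0 : c (hist_init (run chi y)) = 0%R by apply/eqP; rewrite eq_le cle c0.
by rewrite /mix /stop_at /= ci0 !mul0r !mul0e adde0.
Qed.

Lemma Vcost_eq_ae n : Vcost n < +oo ->
  Vcost n = Scost n + Ccost n.+1 + Rcost n.+1 ->
  {ae mupow mu n.+1, forall y, Cset chi psi y ->
    (\1_[set h : hist X Y n.+1 | (l h < (f1 h)%:E + Rl h)%E] (run chi y)
       <= psi (run chi y)
     <= \1_[set h : hist X Y n.+1 | (l h <= (f1 h)%:E + Rl h)%E]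
          (run chi y))%R}.
Proof.
rewrite mixE => Voo E.
apply: filterS (ge0_integral_eq_ae (@mVc n) (@mmix n) _ _ _ Voo E)
  => [y /= + cy|y|y|y].
- by move/(Vlim_eq_mix cy).
- exact: Vc0.
- rewrite fin_numM//; have [a [b [_ _ ->]]] := Vlim_real (run chi y).
  by [].
- exact: Vlim_le_mix.
Qed.

(** * The vanishing remainder and the total cost of a strategy *)

Lemma Rcost_ge0 n : 0 <= Rcost n.
Proof. by apply: integral_ge0 => y _; rewrite mule_ge0 ?lee_fin. Qed.

Lemma Scost_ge0 n : 0 <= Scost n.
Proof. by apply: integral_ge0 => y _; rewrite mule_ge0 ?lee_fin. Qed.

Lemma Ccost_ge0 n : 0 <= Ccost n.
Proof. exact: expectation_under_ge0. Qed.

(** Bounding [R] by the loss of accepting [i1] leaves a finite combination of survival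
    probabilities, all of which tend to 0 in the class. *)
Lemma Rcost_le_loss n : Rcost n <= \sum_(i < k | i != i1)
  (lambda i i1)%:E * expectation_under mu f chi i (cn n).
Proof.
have mw i : measurable_fun setT (fun y : n.-tuple Y =>
    (lambda i i1)%:E *
      ((c (run chi y))%:E * (joint_density f i (run chi y))%:E)).
  by apply: measurable_funeM; exact: (measurable_weight_run (@mc n) (@mf i n)).
have w0 i (y : n.-tuple Y) :
    0 <= (lambda i i1)%:E *
      ((c (run chi y))%:E * (joint_density f i (run chi y))%:E).
  by rewrite !mule_ge0 ?lee_fin ?(joint_density_ge0 hf).
rewrite -big_filter; set s := [seq i <- _ | _].
rewrite [leRHS](_ : _ = \int[mupow mu n]_y \sum_(i <- s) (lambda i i1)%:E *
    ((c (run chi y))%:E * (joint_density f i (run chi y))%:E)); last first.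
  rewrite ge0_integral_sum//=.
  apply: eq_bigr => i _; rewrite ge0_integralZl_EFin//.
    by move=> y _; rewrite mule_ge0 ?lee_fin ?(joint_density_ge0 hf).
  exact: (measurable_weight_run (@mc n) (@mf i n)).
apply: ge0_le_integral => //.
- by move=> y _; rewrite mule_ge0 ?lee_fin.
- exact: mRw.
- exact: emeasurable_sum.
- move=> y _.
  apply: (@le_trans _ _ ((c (run chi y))%:E *
    (decision_loss f lambda i1 (run chi y))%:E)).
    apply: lee_wpmul2l; rewrite ?lee_fin//.
    exact: (Rlim_le_loss hf lambda_ge0 hmin _ (@chi 0%N ([tuple], [tuple]))).
  rewrite -EFinM /decision_loss mulr_sumr -sumEFin /s big_filter.
  by apply: lee_sum => i _; rewrite -!EFinM lee_fin mulrCA.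
Qed.

Lemma Rcost_cvg0 : Rcost @ \oo --> 0.
Proof.
apply: (@squeeze_cvge _ _ _ _ (cst 0) _ (fun n => \sum_(i < k | i != i1)
  (lambda i i1)%:E * expectation_under mu f chi i (cn n))).
- by apply: nearW => n; rewrite Rcost_ge0 Rcost_le_loss.
- exact: cvg_cst.
- rewrite [X in _ --> X](_ : _ = \sum_(i < k | i != i1) 0);
    last by rewrite big1.
  apply: cvg_nnesum => [i _|i _].
    apply: nearW => n; rewrite mule_ge0 ?lee_fin// expectation_under_ge0//.
  rewrite -[X in _ --> X](mule0 (lambda i i1)%:E).
  by apply: cvgeZl.
Qed.

Lemma Rcost0 : Rcost 0 = Rl (([tuple], [tuple]) : hist X Y 0).
Proof. by rewrite /Rcost /run_integral integral_mupow0 ?mul1e. Qed.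

Lemma Vcost0 : Vcost 0 = \int[mu]_y Vl (run chi [tuple y]).
Proof.
rewrite Vcost_integral integral_mupow0//= mul1e.
(* [trcons] on the empty tuple and [[tuple y]] have the same underlying sequence but different size
   proofs. *)
by apply: eq_integral => y _; congr (Vl (run chi _)); exact: val_inj.
Qed.

Lemma Rlim0_lty : Rl (([tuple], [tuple]) : hist X Y 0) < +oo.
Proof. by rewrite -ge0_fin_numE. Qed.

(** The added 1 is [Ccost 0], the term of the expected sample number that the shifted sum omits. *)
Lemma sum_cost : \sum_(n <oo) (Scost n + Ccost n.+1) + 1 =
  \sum_(n <oo) Scost n + sample_number mu f i1 chi psi.
Proof.
rewrite nneseriesD; last 2 first.
- by move=> *; exact: Scost_ge0.
- by move=> *; exact: Ccost_ge0.
rewrite sample_numberE -addeA; congr (_ + _).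
rewrite [RHS](nneseries_split 0 1)//; last by move=> *; exact: Ccost_ge0.
rewrite big_nat1 expectation_continue0 addeC add0n; congr (_ + _).
rewrite -(nneseries_addn 1); last by move=> *; exact: Ccost_ge0.
by apply: eq_eseriesr => n _; rewrite addn1.
Qed.

Lemma Rlim0_le : Rl (([tuple], [tuple]) : hist X Y 0) + 1 <=
  \sum_(n <oo) Scost n + sample_number mu f i1 chi psi.
Proof.
rewrite -sum_cost leeD2r// -Rcost0.
apply: (telescoping_le (r := Rcost)) => [n|n|].
- by rewrite adde_ge0 ?Scost_ge0 ?Ccost_ge0.
- exact: le_trans (Rcost_le n) (Vcost_le n).
- exact: Rcost_cvg0.
Qed.

(** Every link of the chain is an equality: by (a) from [Vcost] on, and from [Rcost] to [Vcost] by
    (c) at 0 and by (b) afterwards. *)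
Lemma Rlim0_eq : conditions_abc mu f i1 lambda chi psi ->
  Rl (([tuple], [tuple]) : hist X Y 0) + 1 =
  \sum_(n <oo) Scost n + sample_number mu f i1 chi psi.
Proof.
move=> [ca cb cc]; rewrite -sum_cost -Rcost0; congr (_ + _).
apply: (telescoping_eq (r := Rcost)) => [n|n|].
- by rewrite adde_ge0 ?Scost_ge0 ?Ccost_ge0.
- rewrite -Vcost_eq; last exact: ca.
  by case: n => [|n]; [rewrite Rcost0 Vcost0 cc|apply: Rcost_eq; exact: cb].
- exact: Rcost_cvg0.
Qed.

(** A total cost that does not exceed the lower bound forces equality in every link of the chain,
    with finite terms; the almost-everywhere equality cases then give (a) and (b), and the link at 0
    gives (c). *)
Lemma conditions_abc_of_eq :
  \sum_(n <oo) Scost n + sample_number mu f i1 chi psi <=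
  Rl (([tuple], [tuple]) : hist X Y 0) + 1 ->
  conditions_abc mu f i1 lambda chi psi.
Proof.
rewrite -sum_cost leeD2rE// -Rcost0 => SR.
have RV n : Rcost n = Vcost n /\ Vcost n = Scost n + Ccost n.+1 + Rcost n.+1 /\
    Rcost n < +oo.
  apply: (telescoping_rigid (a := fun n => Scost n + Ccost n.+1))
    => // [m|m|m||].
  - by rewrite adde_ge0 ?Scost_ge0 ?Ccost_ge0.
  - exact: Rcost_le.
  - exact: Vcost_le.
  - exact: Rcost_cvg0.
  - by rewrite Rcost0; exact: Rlim0_lty.
split.
- by move=> n; have [E [EV Roo]] := RV n; apply: Vcost_eq_ae; rewrite -?E// E.
- by move=> n; have [E [EV Roo]] := RV n.+1; exact: Rcost_eq_ae.
- by have [E _] := RV 0%N; rewrite /condition_c -Vcost0 -E Rcost0.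
Qed.

End strategy.

(** * The error probabilities *)

Section lagrangian.
Context dX dY (X : measurableType dX) (Y : measurableType dY) (R : realType).
Variable mu : {sigma_finite_measure set Y -> \bar R}.
Context (k : nat) (f : 'I_k -> X * Y -> R).
Hypothesis hf : density_family mu f.
Variables (lam : 'I_k -> R).
Hypothesis lam_ge0 : forall i, 0 <= lam i.
Variables (chi : control X Y) (psi : stopping X Y R) (phi : decision X Y R k).
Hypotheses (hchi : control_policy chi) (hpsi : stopping_rule psi).
Hypothesis (hphi : decision_rule phi).
Local Open Scope ereal_scope.

Let lambda := fun i _ : 'I_k => lam i.

Let lambda_ge0 i j : (0 <= lambda i j)%R. Proof. exact: lam_ge0. Qed.

Let Ephi i j n : \bar R :=
  expectation_under mu f chi i (fun h => stop_at psi h * @phi n j h)%R.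

Let phi_ge0 n j h : (0 <= @phi n j h)%R.
Proof. by have [_ + _] := hphi n; exact. Qed.

Let Ephi_ge0 i j n : 0 <= Ephi i j n.
Proof.
apply: expectation_under_ge0 => // h; rewrite mulr_ge0 ?phi_ge0//.
exact: stop_at_ge0.
Qed.

Lemma beta_ge0 i : 0 <= beta mu f chi psi phi i.
Proof.
apply: sume_ge0 => j _; rewrite /alpha.
by apply: nneseries_ge0 => n _ _; exact: Ephi_ge0.
Qed.

(** The contribution of stopping at this stage to the weighted sum of the error probabilities,
    arranged by the accepted hypothesis instead of the true one. *)
Definition risk n (h : hist X Y n.+1) : R :=
  (stop_at psi h * \sum_(j < k) @phi n j h * decision_loss f lambda j h)%R.

Lemma risk_integral n :
  \sum_(i < k) \sum_(j < k | j != i) (lam i)%:E * Ephi i j n =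
  run_integral mu chi (fun h : hist X Y n.+1 => (risk h)%:E).
Proof.
pose G i j (y : n.+1.-tuple Y) : R := (if j != i then lam i *
  (stop_at psi (run chi y) * @phi n j (run chi y) *
   joint_density f i (run chi y)) else 0)%R.
have mrun := measurable_run (n := n.+1) hchi.
have mW i j : measurable_fun setT (fun y : n.+1.-tuple Y =>
    (stop_at psi (run chi y) * @phi n j (run chi y) *
     joint_density f i (run chi y))%R).
  have [mphi _ _] := hphi n.
  apply: measurable_funM; first apply: measurable_funM.
  - exact: (measurableT_comp (measurable_stop_at (n := n) hpsi) mrun).
  - exact: (measurableT_comp (mphi j) mrun).
  - exact: (measurableT_comp (measurable_joint_density hf i (n := n.+1)) mrun).
have W0 i j (y : n.+1.-tuple Y) : (0 <= stop_at psi (run chi y) *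
    @phi n j (run chi y) * joint_density f i (run chi y))%R.
  apply: mulr_ge0; last exact: (joint_density_ge0 hf).
  by apply: mulr_ge0; [exact: stop_at_ge0|exact: phi_ge0].
have mG i j : measurable_fun setT (fun y => (G i j y)%:E).
  apply/measurable_EFinP; rewrite /G; case: (j != i) => //.
  exact: (measurable_funM (@measurable_cst _ _ _ _ _ _) (mW i j)).
have G0 i j y : 0 <= (G i j y)%:E.
  by rewrite lee_fin /G; case: ifP => // _; rewrite mulr_ge0.
transitivity (\sum_(i < k) \sum_(j < k) \int[mupow mu n.+1]_y (G i j y)%:E).
  apply: eq_bigr => i _; rewrite big_mkcond; apply: eq_bigr => j _.
  rewrite /G; case: (j != i); last by rewrite integral0.
  under eq_integral do rewrite EFinM.
  rewrite ge0_integralZl_EFin//.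
  - by move=> y _; rewrite lee_fin.
  - by apply/measurable_EFinP; exact: mW.
transitivity (\int[mupow mu n.+1]_y \sum_(i < k) \sum_(j < k) (G i j y)%:E).
  rewrite ge0_integral_sum//.
  - by apply: eq_bigr => i _; rewrite ge0_integral_sum.
  - by move=> i; exact: emeasurable_sum.
  - by move=> i y _; exact: sume_ge0.
apply: eq_integral => y _; under eq_bigr do rewrite sumEFin.
(* Exchanging the sums over true and accepted hypotheses collects, for each accepted [j], the terms
   with [i != j], which form [decision_loss]. *)
rewrite sumEFin; congr EFin; rewrite exchange_big /= /risk mulr_sumr.
apply: eq_bigr => j _; rewrite /decision_loss mulrA mulr_sumr [RHS]big_mkcond.
apply: eq_bigr => i _; rewrite /G eq_sym; case: ifP => // _.
by rewrite /lambda; ring.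
Qed.

Lemma sum_beta : \sum_(i < k) (lam i)%:E * beta mu f chi psi phi i =
  \sum_(n <oo) run_integral mu chi (fun h : hist X Y n.+1 => (risk h)%:E).
Proof.
under [RHS]eq_eseriesr do rewrite -risk_integral.
have LE i j n : 0 <= (lam i)%:E * Ephi i j n by rewrite mule_ge0 ?lee_fin.
rewrite nneseries_sum; last by move=> i n _; exact: sume_ge0.
apply: eq_bigr => i _; rewrite nneseries_sum//.
rewrite /beta ge0_sume_distrr; last first.
  by move=> j _; apply: nneseries_ge0 => n _ _; exact: Ephi_ge0.
by apply: eq_bigr => j _; rewrite nneseriesZl.
Qed.

Let lfun_real n (h : hist X Y n.+1) (i1 : 'I_k) : exists2 a : R,
  lfun f lambda h = a%:E & forall j, (a <= decision_loss f lambda j h)%R.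
Proof.
have [j lj] := lfun_attained f i1 lambda h.
by exists (decision_loss f lambda j h) => // j'; rewrite -lee_fin -lj lfun_le.
Qed.

Let sum_phi n h a : (\sum_(j < k) @phi n j h * a)%R = a :> R.
Proof. by have [_ _ s1] := hphi n; rewrite -mulr_suml s1 mul1r. Qed.

Let mrisk n : measurable_fun setT
  (fun y : n.+1.-tuple Y => (risk (run chi y))%:E).
Proof.
have mrun := measurable_run (n := n.+1) hchi; have [mphi _ _] := hphi n.
apply/measurable_EFinP; apply: (measurableT_comp _ mrun) => /=.
apply: measurable_funM; first exact: measurable_stop_at.
apply: measurable_sum => j; apply: measurable_funM => //.
exact: (measurable_decision_loss hf).
Qed.

(** The weights [phi] sum to 1, so the averaged loss is at least the smallest one. *)
Lemma Scost_le_risk (i1 : 'I_k) n : Scost mu f lambda chi psi n <=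
  run_integral mu chi (fun h : hist X Y n.+1 => (risk h)%:E).
Proof.
have mrun := measurable_run (n := n.+1) hchi.
have s0 (h : hist X Y n.+1) : (0 <= stop_at psi h)%R by exact: stop_at_ge0.
apply: ge0_le_integral => //.
- by move=> y _; rewrite mule_ge0 ?lee_fin// (lfun_ge0 hf i1 lambda_ge0).
- apply: emeasurable_funM.
    apply/measurable_EFinP.
    exact: (measurableT_comp (measurable_stop_at (n := n) hpsi) mrun).
  exact: (measurableT_comp (measurable_lfun hf _ (n := n.+1)) mrun).
- exact: mrisk.
- move=> y _; have [a -> la] := lfun_real (run chi y) i1.
  rewrite -EFinM lee_fin ler_wpM2l// -(sum_phi (run chi y) a).
  by apply: ler_sum => j _; rewrite ler_wpM2l.
Qed.

(** An optimal rule puts weight only on hypotheses whose loss equals [l]; all other terms are 0. *)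
Lemma Scost_eq_risk (i1 : 'I_k) n : optimal_decision f lambda phi ->
  Scost mu f lambda chi psi n =
  run_integral mu chi (fun h : hist X Y n.+1 => (risk h)%:E).
Proof.
move=> ophi; apply: eq_integral => y _.
have [a la _] := lfun_real (run chi y) i1; rewrite la -EFinM; congr EFin.
rewrite /risk -{1}(sum_phi (run chi y) a); congr (_ * _)%R.
apply: eq_bigr => j _; have := ophi n j (run chi y).
rewrite indicE; case: (boolP (_ \in _)) => [|_ phi_le0].
  by rewrite inE /= la => -[->].
have -> : @phi n j (run chi y) = 0%R.
  by apply/eqP; rewrite eq_le phi_le0 phi_ge0.
by rewrite !mul0r.
Qed.

Lemma sum_Scost_le (i1 : 'I_k) : \sum_(n <oo) Scost mu f lambda chi psi n <=
  \sum_(i < k) (lam i)%:E * beta mu f chi psi phi i.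
Proof.
rewrite sum_beta; apply: lee_nneseries => n _.
  by move=> _; exact: (Scost_ge0 hf i1 lambda_ge0).
exact: Scost_le_risk.
Qed.

Lemma sum_Scost_eq (i1 : 'I_k) : optimal_decision f lambda phi ->
  \sum_(n <oo) Scost mu f lambda chi psi n =
  \sum_(i < k) (lam i)%:E * beta mu f chi psi phi i.
Proof.
move=> ophi; rewrite sum_beta; apply: eq_eseriesr => n _.
exact: Scost_eq_risk.
Qed.

End lagrangian.

Local Close Scope classical_set_scope.

(** * Comparison of the two procedures *)

Theorem theorem9
  (dX dY : measure_display) (X : measurableType dX) (Y : measurableType dY)
  (R : realType) (mu : {sigma_finite_measure set Y -> \bar R})
  (k : nat) (hk : (2 <= k)%N)
  (f : 'I_k -> X * Y -> R) (hf : density_family mu f)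
  (lam : 'I_k -> R) (hlam : forall i, 0 < lam i) :
  let i1 := first_hyp hk in
  let lambda := fun i _ : 'I_k => lam i in
  minima_defined mu f i1 lambda ->
  forall (chi : control X Y) (psi : stopping X Y R),
  classF mu f chi psi ->
  conditions_abc mu f i1 lambda chi psi ->
  forall phi : decision X Y R k,
  decision_rule phi ->
  optimal_decision f lambda phi ->
  forall (chi' : control X Y) (psi' : stopping X Y R) (phi' : decision X Y R k),
  classF mu f chi' psi' ->
  decision_rule phi' ->
  (forall i, (beta mu f chi' psi' phi' i <= beta mu f chi psi phi i)%E) ->
  [/\ (sample_number mu f i1 chi psi <= sample_number mu f i1 chi' psi')%E,
      (exists i, (beta mu f chi' psi' phi' i < beta mu f chi psi phi i)%E) ->
        (sample_number mu f i1 chi psi < sample_number mu f i1 chi' psi')%E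
    & (forall i, beta mu f chi' psi' phi' i = beta mu f chi psi phi i) ->
        sample_number mu f i1 chi' psi' = sample_number mu f i1 chi psi ->
        conditions_abc mu f i1 lambda chi' psi'].

Proof.
move=> i1 lambda hmin chi psi [hchi hpsi hF] habc phi hphi ophi.
move=> chi' psi' phi' [hchi' hpsi' hF'] hphi' bb.
have lam_ge0 i : 0 <= lam i by exact: ltW.
have lambda_ge0 i j : 0 <= lambda i j by exact: lam_ge0.
set N := sample_number mu f i1 chi psi.
set N' := sample_number mu f i1 chi' psi'.
pose B := (\sum_(i < k) (lam i)%:E * beta mu f chi psi phi i)%E.
pose B' := (\sum_(i < k) (lam i)%:E * beta mu f chi' psi' phi' i)%E.
(* [K] is the value of the Lagrangian for the given procedure, [K = B + N], and a lower bound for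
   the other one, [K <= B' + N']. *)
pose K := (Rlim mu f i1 lambda (([tuple], [tuple]) : hist X Y 0) + 1)%E.
have Koo : (K < +oo)%E.
  by rewrite lte_add_pinfty ?ltry// (Rlim0_lty hf lambda_ge0 hmin chi).
have KE : (K = B + N)%E.
  by rewrite /K (Rlim0_eq hf lambda_ge0 hmin hchi hpsi hF habc)
    (sum_Scost_eq hf lam_ge0 hchi hpsi hphi i1 ophi).
have SB' := sum_Scost_le hf lam_ge0 hchi' hpsi' hphi' i1.
have KE' : (K <= B' + N')%E.
  apply: le_trans (Rlim0_le hf lambda_ge0 hmin hchi' hpsi' hF') _.
  exact: leeD2r.
have b0 i : (0 <= beta mu f chi psi phi i)%E by exact: beta_ge0.
have b0' i : (0 <= beta mu f chi' psi' phi' i)%E by exact: beta_ge0.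
have lb i : ((lam i)%:E * beta mu f chi' psi' phi' i <=
    (lam i)%:E * beta mu f chi psi phi i)%E.
  by apply: lee_wpmul2l; rewrite ?lee_fin.
have lb0 i : (0 <= (lam i)%:E * beta mu f chi psi phi i)%E.
  by rewrite mule_ge0 ?lee_fin.
have lb0' i : (0 <= (lam i)%:E * beta mu f chi' psi' phi' i)%E.
  by rewrite mule_ge0 ?lee_fin.
have B0 : (0 <= B)%E by exact: sume_ge0.
have B0' : (0 <= B')%E by exact: sume_ge0.
have N0 : (0 <= N)%E.
  rewrite /N (sample_numberE hf i1 hchi hpsi hF); apply: nneseries_ge0 => n _ _.
  exact: (Ccost_ge0 hf).
have N0' : (0 <= N')%E.
  rewrite /N' (sample_numberE hf i1 hchi' hpsi' hF').
  by apply: nneseries_ge0 => n _ _; exact: (Ccost_ge0 hf).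
(* [B] and [N] are nonnegative with finite sum [K], so each is finite and may be cancelled. *)
have Bfin : B \is a fin_num.
  by rewrite ge0_fin_numE//; apply: le_lt_trans Koo; rewrite KE leeDl.
have Nfin : N \is a fin_num.
  by rewrite ge0_fin_numE//; apply: le_lt_trans Koo; rewrite KE leeDr.
have BB' : (B' <= B)%E by apply: lee_sum => i _; exact: lb.
split.
- by rewrite -(leeD2lE _ _ Bfin) -KE; apply: le_trans KE' _; exact: leeD2r.
(* If [N' <= N], the strict error inequality and [lam i > 0] would give [B' + N' < B + N = K],
   against the lower bound. *)
- move=> [i bi]; rewrite ltNge; apply/negP => N'N.
  have BltB : (B' < B)%E.
    rewrite /B' /B (bigD1 i)//= [ltRHS](bigD1 i)//=.
    apply: lte_leD.
    + rewrite ge0_fin_numE ?sume_ge0//; apply: le_lt_trans (_ : (B' < +oo)%E).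
        by rewrite /B' [leRHS](bigD1 i)//= leeDr.
      by apply: le_lt_trans BB' _; rewrite -ge0_fin_numE.
    + by rewrite lte_pmul2l// lte_fin.
    + by apply: lee_sum => j _; exact: lb.
  have N'fin : N' \is a fin_num.
    by rewrite ge0_fin_numE//; apply: le_lt_trans N'N _; rewrite -ge0_fin_numE.
  have := le_lt_trans KE' (lte_leD N'fin BltB N'N).
  by rewrite KE ltxx.
- move=> bE NE.
  apply: (conditions_abc_of_eq hf lambda_ge0 hmin hchi' hpsi' hF').
  (* With equal errors and equal sample numbers, the second strategy costs at most [B + N = K],
     which is the equality case. *)
  rewrite -/N' NE -/K KE; apply: leeD2r; apply: le_trans SB' _.
  by rewrite /B; apply: lee_sum => j _; rewrite bE.
Qed.
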